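(* Let $(X,\mathcal{E})$ be a ballean and let $z\in X$. For $\varepsilon\in\mathcal{E}$ and $n\in\mathbb{N}$ put $\mathcal{D}_\varepsilon=\{x-y:(x,y)\in\varepsilon\}\subseteq\mathbb{V}(X)$ and let $\mathcal{S}_{n,\varepsilon}$ be the (Minkowski) sum of $n$ copies of $[-n,n]\mathcal{D}_\varepsilon$. Then the family $$\{\mathcal{S}_{n,\varepsilon}+[-n,n]z:\ \varepsilon\in\mathcal{E},\ n\in\mathbb{N}\}$$ is a base of the free vector ideal $\mathcal{I}_{(X,\mathcal{E})}$ over $(X,\mathcal{E})$.
   Context: A coarse structure on a set $X$ is a family $\mathcal{E}$ of subsets of $X\times X$ such that: each $\varepsilon\in\mathcal{E}$ contains the diagonal $\Delta_X=\{(x,x):x\in X\}$; if $\varepsilon,\delta\in\mathcal{E}$ then $\varepsilon\circ\delta=\{(x,y):\exists z\,((x,z)\in\varepsilon,\ (z,y)\in\delta)\}\in\mathcal{E}$ and $\varepsilon^{-1}=\{(y,x):(x,y)\in\varepsilon\}\in\mathcal{E}$; if $\varepsilon\in\mathcal{E}$ and $\Delta_X\subseteq\varepsilon'\subseteq\varepsilon$ then $\varepsilon'\in\mathcal{E}$; for any $x,y\in X$ there is $\varepsilon\in\mathcal{E}$ with $(x,y)\in\varepsilon$. The pair $(X,\mathcal{E})$ is called a ballean. Write $\varepsilon[x]=\{y\in X:(x,y)\in\varepsilon\}$. A mapping $f:(X,\mathcal{E})\to(X',\mathcal{E}')$ between balleans is coarse if for every $\varepsilon\in\mathcal{E}$ there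 is $\varepsilon'\in\mathcal{E}'$ such that $f(\varepsilon[x])\subseteq\varepsilon'[f(x)]$ for every $x\in X$. For $Y\subseteq X$, the subballean on $Y$ is $(Y,\mathcal{E}_Y)$ with $\mathcal{E}_Y=\{\varepsilon\cap(Y\times Y):\varepsilon\in\mathcal{E}\}$. ''$(X,\mathcal{E})$ is a subballean of a ballean $(Z,\mathcal{F})$'', where $X\subseteq Z$, means $\mathcal{E}=\mathcal{F}_X$. A vector ideal on a real vector space $\mathcal{V}$ is a family $\mathcal{I}$ of subsets of $\mathcal{V}$ such that: (1) if $U,U'\in\mathcal{I}$ and $W\subseteq U$ then $U\cup U'\in\mathcal{I}$ and $W\in\mathcal{I}$; (2) if $U\in\mathcal{I}$ then $U+U\in\mathcal{I}$; (3) if $U\in\mathcal{I}$ and $\lambda>0$ then $[-\lambda,\lambda]U=\bigcup\{\lambda'U:\lambda'\in[-\lambda,\lambda]\}\in\mathcal{I}$; (4) $\bigcup\mathcal{I}=\mathcal{V}$. A subfamily $\mathcal{I}'\subseteq\mathcal{I}$ is a base for $\mathcal{I}$ if each $U\in\mathcal{I}$ is contained in some $U'\in\mathcal{I}'$. A vector ballean $(\mathcal{V},\mathcal{I})$ is a real vector space $\mathcal{V}$ with a vector ideal $\mathcal{I}$, regarded as a ballean whose coarse structure consists of all $\varepsilon\subseteq\mathcal{V}\times\mathcal{V}$ with $\Delta_{\mathcal{V}}\subseteq\varepsilon\subseteq\{(x,y):x-y\in U\}$ for some $U\in\mathcal{I}$. $\mathbb{V}(X)$ denotes the real vector space with basis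 $X$. The free vector ideal $\mathcal{I}_{(X,\mathcal{E})}$ is the unique vector ideal on $\mathbb{V}(X)$ such that (i) $(X,\mathcal{E})$ is a subballean of $(\mathbb{V}(X),\mathcal{I}_{(X,\mathcal{E})})$, and (ii) for every vector ballean $(\mathcal{V},\mathcal{I})$, every coarse mapping $(X,\mathcal{E})\to(\mathcal{V},\mathcal{I})$ extends to a unique coarse linear mapping $(\mathbb{V}(X),\mathcal{I}_{(X,\mathcal{E})})\to(\mathcal{V},\mathcal{I})$. Here $\mathbb{N}=\{1,2,\dots\}$, and $[-n,n]z=\{\lambda z:\lambda\in[-n,n]\}$. *)

(* Defs.v *)
From mathcomp Require Import all_boot all_order all_algebra.
From mathcomp Require Import freeg.
From mathcomp Require Import all_classical reals.

Set Implicit Arguments.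
Unset Strict Implicit.
Unset Printing Implicit Defensive.

Import Order.TTheory GRing.Theory Num.Theory.

Local Open Scope classical_set_scope.
Local Open Scope ring_scope.

(* The library composition is right to left: [d \; e] relates x to y when
   [e (x, z)] and [d (z, y)] for some z. *)
Record coarse_structure (X : Type) (E : set_system (X * X)) : Prop :=
  CoarseStructure {
    coarse_diagonal : forall e, E e -> diagonal `<=` e ;
    coarse_comp : forall e d, E e -> E d -> E (d \; e)%relation ;
    coarse_inv : forall e, E e -> E (e^-1)%relation ;
    coarse_sub : forall e e', E e -> diagonal `<=` e' -> e' `<=` e -> E e' ;
    coarse_connected : forall x y : X, exists2 e, E e & e (x, y)
  }.

Definition coarse_map (X X' : Type) (E : set_system (X * X))
    (E' : set_system (X' * X')) (f : X -> X') : Prop :=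
  forall e, E e -> exists2 e', E' e' &
    forall x, f @` xsection e x `<=` xsection e' (f x).

(* The trace F_X of F on X, where X is regarded as a subset of Z by means of an
   injection [i]. *)
Definition subballean_along (X Z : Type) (i : X -> Z)
    (F : set_system (Z * Z)) : set_system (X * X) :=
  [set (fun p : X * X => (i p.1, i p.2)) @^-1` e | e in F].

Section VectorIdeals.
Variables (R : realType) (V : lmodType R).
Implicit Types (U W : set V) (I B : set_system V).

Definition set_sum U W : set V := [set u + w | u in U & w in W].

Definition set_nsum (n : nat) U : set V :=
  [set \sum_(i < n) u i | u in [set u : 'I_n -> V | forall i, U (u i)]].

Definition set_scale (l : R) U : set V :=
  [set a *: u | a in [set a | - l <= a <= l] & u in U].

Record vector_ideal I : Prop := VectorIdeal {
  vector_idealU : forall U U' W, I U -> I U' -> W `<=` U ->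
    I (U `|` U') /\ I W ;
  vector_idealD : forall U, I U -> I (set_sum U U) ;
  vector_idealZ : forall U (l : R), I U -> 0 < l -> I (set_scale l U) ;
  vector_ideal_cover : \bigcup_(U in I) U = setT
}.

Definition ideal_base I B : Prop :=
  B `<=` I /\ forall U, I U -> exists2 U', B U' & U `<=` U'.

Definition ideal_entourages I : set_system (V * V) :=
  [set e | exists2 U, I U &
    diagonal `<=` e /\ e `<=` [set p | U (p.1 - p.2)]].

End VectorIdeals.

(* The real vector space with basis X. [{classic X}] is X with the choice
   structure required by [{freeg _ / _}]. *)
Definition free_vect (R : realType) (X : Type) : lmodType R :=
  {freeg {classic X} / R}.

Definition free_vect_basis (R : realType) (X : Type) (x : X) :
  free_vect R X := << (x : {classic X}) >>.

Arguments free_vect_basis R {X} x.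

Record is_free_vector_ideal (R : realType) (X : Type) (E : set_system (X * X))
    (I : set_system (free_vect R X)) : Prop := IsFreeVectorIdeal {
  free_ideal_ideal : vector_ideal I ;
  free_ideal_subballean :
    E = subballean_along (free_vect_basis R) (ideal_entourages I) ;
  free_ideal_universal :
    forall (V : lmodType R) (J : set_system V), vector_ideal J ->
    forall f : X -> V, coarse_map E (ideal_entourages J) f ->
    exists! F : free_vect R X -> V,
      [/\ linear F,
          coarse_map (ideal_entourages I) (ideal_entourages J) F
        & forall x, F (free_vect_basis R x) = f x]
}.

Lemma free_vect_linear_id (R : realType) (X : Type)
    (F : free_vect R X -> free_vect R X) :
  linear F -> (forall x, F (free_vect_basis R x) = free_vect_basis R x) ->
  F = id.
Proof.
move=> linF Fb; apply/funext => D.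
have FD u v : F (u + v) = F u + F v by rewrite -{1}[u]scale1r linF scale1r.
have F0 : F 0 = 0 by apply: (addrI (F 0)); rewrite -FD !addr0.
have FZ a u : F (a *: u) = a *: F u by rewrite -[a *: u]addr0 linF F0 addr0.
rewrite -(freeg_sumE D); elim/big_ind: _ => [//|u v Fu Fv|x _].
  by rewrite FD Fu Fv.
have -> : << coeff x D *g x >> = coeff x D *: free_vect_basis R x.
  by apply/eqP/freeg_eqP => y; rewrite coeffZ !coeffU mul1r.
by rewrite FZ Fb.
Qed.

(* Any two free vector ideals coincide: each is contained in the other because
   the extension of the coarse inclusion of X is the identity. *)
Lemma free_vector_ideal_unique (R : realType) (X : Type)
    (E : set_system (X * X)) (I J : set_system (free_vect R X)) :
  is_free_vector_ideal E I -> is_free_vector_ideal E J -> I = J.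
Proof.
have sub (I1 J1 : set_system (free_vect R X)) : is_free_vector_ideal E I1 ->
    is_free_vector_ideal E J1 -> I1 `<=` J1.
  move=> freeI freeJ U IU.
  have cb : coarse_map E (ideal_entourages J1) (free_vect_basis R).
    move=> e; rewrite (free_ideal_subballean freeJ) => -[e' Je' <-].
    exists e' => // x _ [y + <-]; rewrite /xsection /= !inE.
    by [].
  have [F [[linF coF Fb] _]] :=
    free_ideal_universal freeI (free_ideal_ideal freeJ) cb.
  rewrite (free_vect_linear_id linF Fb) {F linF Fb} in coF.
  have idI := free_ideal_ideal freeI.
  have [W0 IW0 W00] : (\bigcup_(W0 in I1) W0) 0.
    by rewrite (vector_ideal_cover idI).
  have [IUW0 _] := vector_idealU idI IU IW0 (@subset_refl _ U).
  have [|e' [W JW [_ e'W]] sube'] :=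
      coF (diagonal `|` [set p | (U `|` W0) (p.1 - p.2)]).
    exists (U `|` W0) => //; split; first exact: subsetUl.
    by move=> [x y] [|//]; rewrite /diagonal /= => ->; rewrite subrr; right.
  have UW : U `<=` W.
    move=> u Uu; rewrite -[u]subr0; apply: (e'W (u, 0)).
    have : xsection e' u 0.
      apply: sube'; exists 0 => //.
      by rewrite /xsection /= inE; right => /=; rewrite subr0; left.
    by rewrite /xsection /= inE.
  by have [_] := vector_idealU (free_ideal_ideal freeJ) JW JW UW.
by move=> freeI freeJ; apply/seteqP; split; apply: sub.
Qed.

(* If there were no free vector ideal, the value would be the empty family,
   which is not a vector ideal. *)
Definition free_vector_ideal (R : realType) (X : Type)
    (E : set_system (X * X)) : set_system (free_vect R X) :=
  xget set0 [set I | is_free_vector_ideal E I].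

Arguments free_vector_ideal R {X} E.

Definition diff_set (R : realType) (X : Type) (e : set (X * X)) :
  set (free_vect R X) :=
  [set free_vect_basis R p.1 - free_vect_basis R p.2 | p in e].

Arguments diff_set R {X} e.

(* Main.v *)
(* The family generates a vector ideal, and this ideal is free, so it is the
   free vector ideal by uniqueness. Linear extensions of coarse maps f are
   coarse because they send S_{n,e} + [-n,n]z into an n-fold sum of dilates of
   {f x - f y : (x,y) in e} plus a dilate of {f z}. The remaining point is that
   the trace on X is not coarser than E: if x - y = sum_{i<n} a_i (u_i - v_i)
   + c z with (u_i, v_i) in e, then x and y are connected in the graph with
   edges {u_i, v_i}, hence related by an entourage depending on n and e only. *)

From HB Require Import structures.
Require Import Defs.
From mathcomp Require Import all_boot all_order all_algebra.
From mathcomp Require Import freeg.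
From mathcomp Require Import all_classical reals.

Set Implicit Arguments.
Unset Strict Implicit.
Unset Printing Implicit Defensive.

Import Order.TTheory GRing.Theory Num.Theory.

Local Open Scope classical_set_scope.
Local Open Scope ring_scope.

(** * Minkowski sums and dilates of sets *)

Section SetOperations.
Variables (R : realType) (V : lmodType R).
Implicit Types U W : set V.

Lemma set_sumS U U' W W' :
  U `<=` U' -> W `<=` W' -> set_sum U W `<=` set_sum U' W'.
Proof.
move=> sU sW _ [u Uu [w Ww <-]].
by exists u; [exact: sU|exists w; [exact: sW|]].
Qed.

Lemma set_scaleS (l l' : R) U U' :
  l <= l' -> U `<=` U' -> set_scale l U `<=` set_scale l' U'.
Proof.
move=> ll' sU _ [a /andP[la al] [u Uu <-]]; exists a.
  by rewrite /= (le_trans _ la) ?lerN2 // (le_trans al).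
by exists u => //; exact: sU.
Qed.

Lemma set_scale0 (l : R) U : 0 <= l -> U !=set0 -> set_scale l U 0.
Proof.
move=> l0 [u Uu]; exists 0; first by rewrite /= oppr_le0 l0.
by exists u => //; rewrite scale0r.
Qed.

Lemma set_nsumD m n U :
  set_sum (set_nsum m U) (set_nsum n U) `<=` set_nsum (m + n) U.
Proof.
move=> _ [_ [u Uu <-] [_ [w Uw <-] <-]].
exists (fun i => match fintype.split i with inl j => u j | inr j => w j end).
  by move=> i; case: fintype.split.
rewrite big_split_ord; congr (_ + _); apply: eq_bigr => i _.
  by rewrite (unsplitK (inl i)).
by rewrite (unsplitK (inr i)).
Qed.

(** The [n - m] missing summands are filled with zeros, whence the condition [U' 0]. *)
Lemma set_nsumS m n U U' : (m <= n)%N -> U' 0 -> U `<=` U' ->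
  set_nsum m U `<=` set_nsum n U'.
Proof.
move=> /subnKC <- U'0 sU x [u Uu <-]; apply: set_nsumD.
exists (\sum_i u i); first by exists u => // i; apply: sU.
exists 0; last by rewrite addr0.
by exists (fun=> 0) => //; rewrite big1.
Qed.

End SetOperations.

(** * Closure properties of vector ideals *)

Section VectorIdealTheory.
Variables (R : realType) (V : lmodType R) (I : set_system V).
Hypothesis idI : vector_ideal I.

Lemma vector_idealS U W : I U -> W `<=` U -> I W.
Proof. by move=> IU WU; have [] := vector_idealU idI IU IU WU. Qed.

Lemma vector_ideal_set1 v : I [set v].
Proof.
have [U IU Uv] : (\bigcup_(U in I) U) v by rewrite (vector_ideal_cover idI).
by apply: vector_idealS IU _ => _ ->.
Qed.

Lemma vector_ideal_sum U W : I U -> I W -> I (set_sum U W).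
Proof.
move=> IU IW.
have [IUW _] := vector_idealU idI IU IW (@subset_refl _ U).
apply: vector_idealS (vector_idealD idI IUW) _.
by apply: set_sumS => x ?; [left|right].
Qed.

Lemma vector_ideal_nsum n U : I U -> I (set_nsum n U).
Proof.
move=> IU; elim: n => [|n IHn].
  apply: vector_idealS (vector_ideal_set1 0) _ => _ [u _ <-].
  by rewrite big_ord0.
apply: vector_idealS (vector_ideal_sum IHn IU) _ => _ [u Uu <-].
rewrite big_ord_recr /=; eexists; last by exists (u ord_max).
by exists (fun i => u (widen_ord (leqnSn n) i)).
Qed.

End VectorIdealTheory.

(** * Linear maps on the free vector space *)

Section FreeVectorSpace.
Variables (R : realType) (X : Type).
Local Notation b := (@free_vect_basis R X).

Lemma free_vect_ind (P : free_vect R X -> Prop) :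
  P 0 -> (forall u v, P u -> P v -> P (u + v)) ->
  (forall a x, P (a *: b x)) -> forall u, P u.
Proof.
move=> P0 PD PZ u; rewrite -(freeg_sumE u); apply: big_ind => // x _.
suff -> : << coeff x u *g x >> = coeff x u *: b x by [].
by apply/eqP/freeg_eqP => y; rewrite coeffZ !coeffU mul1r.
Qed.

Lemma free_vect_linear_eq (V : lmodType R) (F G : free_vect R X -> V) :
  linear F -> linear G -> (forall x, F (b x) = G (b x)) -> F = G.
Proof.
move=> linF linG FG; apply/funext.
have lin0 (H : free_vect R X -> V) : linear H -> H 0 = 0.
  by move=> linH; have := linH (-1) 0 0; rewrite !scaleN1r addNr addNr.
have linD (H : free_vect R X -> V) u v : linear H -> H (u + v) = H u + H v.
  by move=> linH; rewrite -{1}[u]scale1r linH scale1r.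
have linZ (H : free_vect R X -> V) a u : linear H -> H (a *: u) = a *: H u.
  by move=> linH; rewrite -[a *: u]addr0 linH lin0 // addr0.
apply: free_vect_ind => [|u v Fu Fv|a x]; first by rewrite !lin0.
  by rewrite !linD // Fu Fv.
by rewrite !linZ // FG.
Qed.

Lemma free_vect_extension (V : lmodType R) (f : X -> V) :
  exists F : {linear free_vect R X -> V}, forall x, F (b x) = f x.
Proof.
pose F : free_vect R X -> V := @fglift R V {classic X} f.
have FB : {morph F : u v / u - v} by exact: lift_is_additive.
have F0 : F 0 = 0 by rewrite -[0]subr0 FB subrr.
have FN u : F (- u) = - F u by rewrite -[- u]sub0r FB F0 sub0r.
have FD u v : F (u + v) = F u + F v by rewrite -{1}[v]opprK FB FN opprK.
have Fb a x : F (a *: b x) = a *: f x.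
  rewrite -(@liftU R V {classic X} f a x); congr (fglift _ _).
  by apply/eqP/freeg_eqP => y; rewrite coeffZ !coeffU mul1r.
(* Additivity reduces homogeneity to multiples of basis vectors, where [Fb] applies. *)
have FZ a u : F (a *: u) = a *: F u.
  elim/free_vect_ind: u => [|u v Fu Fv|c x].
  - by rewrite !(scaler0, F0).
  - by rewrite scalerDr !FD Fu Fv scalerDr.
  - by rewrite scalerA !Fb scalerA.
have linF : linear F by move=> a u v; rewrite FD FZ.
pose M := GRing.isLinear.Build R (free_vect R X) V *:%R F linF.
pose L : {linear free_vect R X -> V} := HB.pack F M.
by exists L => x; rewrite -[b x]scale1r /= Fb scale1r.
Qed.

(** The linear extension of the indicator of [x] is 1 at [b x] and 0 at every [b y] with [y]
    different from [x]. *)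
Lemma free_vect_basis_inj : injective b.
Proof.
move=> x y bxy; apply: contrapT => nxy.
have [F Fb] := free_vect_extension (fun t => (`[<t = x>])%:R : R^o).
have := congr1 F bxy; rewrite !Fb.
rewrite (asboolT (erefl x)) asboolF => [/eqP|yx]; last exact: nxy.
by rewrite oner_eq0.
Qed.

End FreeVectorSpace.

(** * Upper bounds and generated equivalences in a coarse structure *)

Section CoarseStructure.
Variables (X : Type) (E : set_system (X * X)).
Hypothesis hE : coarse_structure E.

(** Each factor of a composition contains the diagonal, so the composition contains the other
    factor. *)
Lemma coarse_common e d : E e -> E d -> exists2 c, E c & e `|` d `<=` c.
Proof.
move=> Ee Ed; exists (d \; e)%relation; first exact: (coarse_comp hE).
move=> [x y] [xy|xy].
  by exists y => //; exact: (coarse_diagonal hE Ed).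
by exists x => //; exact: (coarse_diagonal hE Ee).
Qed.

(* Adjoining the pair (s, t) to an equivalence relation r amounts to allowing a
   single passage between the r-classes of s and t, so it enlarges an entourage
   containing r in a way that does not depend on the pair. *)
Lemma coarse_equivalence (x0 : X) e n : E e -> exists2 d, E d &
  forall p : nat -> X * X, (forall i, (i < n)%N -> e (p i)) ->
  exists r : X -> X -> Prop,
    [/\ forall x, r x x, forall x y, r x y -> r y x,
        forall x y t, r x y -> r y t -> r x t,
        forall x y, r x y -> d (x, y)
      & forall i, (i < n)%N -> r (p i).1 (p i).2].
Proof.
move=> Ee; elim: n => [|n [d Ed IHd]].
  exists e => // p _; exists eq; split=> //; first by move=> x y t -> ->.
  by move=> x _ <-; exact: (coarse_diagonal hE Ee).
(* [c] contains [e] and its inverse, since the new pair may be crossed in either direction. *)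
have [c Ec sc] := coarse_common Ee (coarse_inv hE Ee).
exists ((d \; c) \; d)%relation; first by do 2?apply: (coarse_comp hE).
move=> p ep.
have [|r [rr rs rt rd rp]] := IHd p; first by move=> i /ltnW; exact: ep.
set s := (p n).1; set t := (p n).2.
have est : e (s, t) by rewrite /s /t -surjective_pairing; exact: ep.
exists (fun x y => [\/ r x y, r x s /\ r t y | r x t /\ r s y]); split.
- by move=> x; constructor 1.
- move=> x y [/rs|[/rs ? /rs ?]|[/rs ? /rs ?]]; first by constructor 1.
    by constructor 3.
  by constructor 2.
- move=> x y u [xy|[xs ty]|[xt sy]] [yu|[ys tu]|[yt su]].
  + by constructor 1; apply: rt yu.
  + by constructor 2; split=> //; apply: rt ys.
  + by constructor 3; split=> //; apply: rt yt.
  + by constructor 2; split=> //; apply: rt yu.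
  + by constructor 2.
  + by constructor 1; apply: rt su.
  + by constructor 3; split=> //; apply: rt yu.
  + by constructor 1; apply: rt tu.
  + by constructor 3.
- have dd x : d (x, x) by exact: rd.
  have cc x : c (x, x) by exact: (coarse_diagonal hE Ec).
  move=> x y [/rd xy|[/rd xs /rd ty]|[/rd xt /rd sy]].
  + by exists x => //=; exists x.
  + by exists s => //=; exists t => //; apply: sc; left.
  + by exists t => //=; exists s => //; apply: sc; right.
- move=> i; rewrite ltnS leq_eqVlt => /predU1P[->|/rp]; last by constructor 1.
  by constructor 2.
Qed.

End CoarseStructure.

(** * The generated ideal and its trace on $X$ *)

Section FreeVectorIdeal.
Variables (R : realType) (X : Type) (E : set_system (X * X)).
Hypothesis hE : coarse_structure E.
Variable z : X.
Local Notation b := (@free_vect_basis R X).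
Local Notation D := (@diff_set R X).

Definition free_ball (e : set (X * X)) (n : nat) : set (free_vect R X) :=
  set_sum (set_nsum n (set_scale n%:R (D e))) (set_scale n%:R [set b z]).

Definition free_balls : set_system (free_vect R X) :=
  [set free_ball e n | e in E & n in [set n : nat | (0 < n)%N]].

(** With the family closed under subsets, being a base is immediate once this ideal is known to be
    the free one. *)
Definition generated_ideal : set_system (free_vect R X) :=
  [set U | exists2 B, free_balls B & U `<=` B].

Lemma diff_set0 e : E e -> D e 0.
Proof.
move=> Ee; exists (z, z); last by rewrite subrr.
exact: (coarse_diagonal hE Ee).
Qed.

Lemma free_ballS e e' m n : E e' -> e `<=` e' -> (m <= n)%N ->
  free_ball e m `<=` free_ball e' n.
Proof.
move=> Ee' ee' mn; apply: set_sumS.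
  apply: set_nsumS => //.
    by apply: set_scale0 => //; exists 0; exact: diff_set0.
  apply: set_scaleS; first by rewrite ler_nat.
  by move=> _ [p ep <-]; exists p => //; exact: ee'.
by apply: set_scaleS => //; rewrite ler_nat.
Qed.

(** Concatenating the two sums gives [n + n] summands, and the two coefficients of [b z] add up to
    at most [n + n] in absolute value. *)
Lemma free_ballD e n : E e ->
  set_sum (free_ball e n) (free_ball e n) `<=` free_ball e (n + n).
Proof.
move=> Ee _ [_ [s Ss [_ [a /andP[la al] [_ -> <-]] <-]]
             [_ [t St [_ [c /andP[lc cl] [_ -> <-]] <-]] <-]].
exists (s + t).
  have : set_nsum (n + n) (set_scale n%:R (D e)) (s + t).
    by apply: set_nsumD; exists s => //; exists t.
  apply: set_nsumS => //.
    by apply: set_scale0 => //; exists 0; exact: diff_set0.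
  by apply: set_scaleS => //; rewrite ler_nat leq_addr.
exists ((a + c) *: b z); last by rewrite scalerDl addrACA.
exists (a + c); last by exists (b z).
by rewrite /= natrD opprD !lerD.
Qed.

(** Scaling raises the bound on the coefficients from [n] to [k * n]; the number of summands stays
    [n] and is padded with zeros to [k * n]. *)
Lemma free_ballZ e n k (l : R) : E e -> (0 < k)%N -> l <= k%:R ->
  set_scale l (free_ball e n) `<=` free_ball e (k * n).
Proof.
move=> Ee k0 lk.
have scaleM (W : set (free_vect R X)) a w : - l <= a <= l ->
    set_scale n%:R W w -> set_scale (k * n)%:R W (a *: w).
  rewrite -ler_norml => al [c /=]; rewrite -ler_norml => cn [v Wv <-].
  exists (a * c); last by exists v; rewrite ?scalerA.
  by rewrite /= -ler_norml normrM natrM ler_pM // (le_trans al).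
move=> _ [a la [_ [_ [u Du <-] [w Ww <-]] <-]].
exists (a *: \sum_(i < n) u i); last first.
  by exists (a *: w); rewrite ?scalerDr //; exact: scaleM.
have : set_nsum n (set_scale (k * n)%:R (D e)) (a *: \sum_(i < n) u i).
  exists (fun i => a *: u i); last by rewrite scaler_sumr.
  by move=> i; exact: scaleM.
apply: set_nsumS => //; first by rewrite leq_pmull.
by apply: set_scale0 => //; exists 0; exact: diff_set0.
Qed.

Lemma generated_idealP U : generated_ideal U <->
  exists e n, [/\ E e, (0 < n)%N & U `<=` free_ball e n].
Proof.
split=> [[_ [e Ee [n n0 <-]] UB]|[e [n [Ee n0 UB]]]]; first by exists e, n.
by exists (free_ball e n) => //; exists e => //; exists n.
Qed.

Lemma generated_ideal_vector_ideal : vector_ideal generated_ideal.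
Proof.
have gD U : generated_ideal U -> generated_ideal (set_sum U U).
  move=> /generated_idealP[e [n [Ee n0 UB]]]; apply/generated_idealP.
  exists e, (n + n)%N; split; rewrite ?addn_gt0 ?n0 //.
  by apply: subset_trans (free_ballD Ee); exact: set_sumS.
have gU U W : generated_ideal U -> generated_ideal W ->
    generated_ideal (U `|` W).
  move=> /generated_idealP[e [m [Ee m0 UB]]].
  move=> /generated_idealP[d [n [Ed n0 WB]]].
  have [c Ec sc] := coarse_common hE Ee Ed; apply/generated_idealP.
  exists c, (maxn m n); split; rewrite ?leq_max ?m0 // => u [/UB|/WB].
    by apply: free_ballS => //; [move=> p ?; apply: sc; left|exact: leq_maxl].
  by apply: free_ballS => //; [move=> p ?; apply: sc; right|exact: leq_maxr].
have gS U W : generated_ideal U -> W `<=` U -> generated_ideal W.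
  by move=> [B ? UB] WU; exists B => //; exact: subset_trans UB.
split=> [U U' W IU IU' WU|//|U l|].
- by split; [exact: gU|exact: gS WU].
- move=> /generated_idealP[e [n [Ee n0 UB]]] l0; apply/generated_idealP.
  have lk := archi_boundP (ltW l0).
  (* [Num.bound l] is a natural number above [l]; the successor makes the factor visibly
     positive. *)
  exists e, ((Num.bound l).+1 * n)%N; split; rewrite ?muln_gt0 ?n0 //.
  apply: subset_trans (free_ballZ (k := (Num.bound l).+1) (l := l) _ _ _) => //.
    exact: set_scaleS.
  by rewrite (le_trans (ltW lk)) // ler_nat.
- apply/seteqP; split=> // u _; elim/free_vect_ind: u => [|u v|a x].
  + have [e Ee _] := coarse_connected hE z z.
    exists (free_ball e 1).
      by exists (free_ball e 1) => //; exists e => //; exists 1%N.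
    exists 0; last first.
      by exists 0; rewrite ?addr0 //; apply: set_scale0 => //; exists (b z).
    exists (fun=> 0); last by rewrite big1.
    by move=> i; apply: set_scale0 => //; exists 0; exact: diff_set0.
  + move=> [U IU Uu] [W IW Wv]; have IUW := gU _ _ IU IW.
    exists (set_sum (U `|` W) (U `|` W)); first exact: gD.
    by exists u; [left|exists v; [right|]].
  (* Write [a x = a (x - z) + a z]: connectedness supplies an entourage containing [(x, z)], and [n]
     is chosen to bound [|a|]. The summand at [z] is what reaches vectors of nonzero
     augmentation. *)
  + have [e Ee exz] := coarse_connected hE x z.
    pose n := (Num.bound `|a|).+1.
    have an : - n%:R <= a <= n%:R.
      rewrite -ler_norml (le_trans (ltW (archi_boundP (normr_ge0 a)))) //.
      by rewrite ler_nat.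
    exists (free_ball e n); first by apply/generated_idealP; exists e, n; split.
    exists (a *: (b x - b z)); last first.
      exists (a *: b z); first by exists a => //; exists (b z).
      by rewrite -scalerDr subrK.
    have : set_nsum 1 (set_scale n%:R (D e)) (a *: (b x - b z)).
      exists (fun=> a *: (b x - b z)); last by rewrite big_ord1.
      by move=> _; exists a => //; exists (b x - b z) => //; exists (x, z).
    apply: set_nsumS => //.
    by apply: set_scale0 => //; exists 0; exact: diff_set0.
Qed.

(* The indicator of the class of x, extended linearly, vanishes on the
   differences u_i - v_i, and the augmentation forces the coefficient of z to
   be zero; so x - y in the ball implies that x and y lie in the same class of
   the equivalence relation generated by the n pairs (u_i, v_i). *)
Lemma free_ball_entourage e n : E e -> exists2 d, E d &
  forall x y, free_ball e n (b x - b y) -> d (x, y).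
Proof.
move=> Ee; have [d Ed dP] := coarse_equivalence hE z n Ee.
exists d => // x y [_ [u Du <-] [_ [c _ [_ -> <-]] xy]].
have /choice[p pP] i : exists q : R * (X * X),
    e q.2 /\ u i = q.1 *: (b q.2.1 - b q.2.2).
  by have [a _ [_ [q eq <-] <-]] := Du i; exists (a, q).
(* [coarse_equivalence] expects a sequence indexed by all naturals; the default [(z, z)] occurs only
   at indices from [n] on, which are never consulted. *)
pose q i := if insub i is Some j then (p j).2 else (z, z).
have qE (i : 'I_n) : q i = (p i).2 by rewrite /q valK.
have [|r [rr rs rt rd rq]] := dP q.
  by move=> i i_n; rewrite (qE (Ordinal i_n)); have [] := pP (Ordinal i_n).
(* A functional that agrees on the two ends of every pair kills all the differences, so only the
   multiple of [b z] survives. *)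
have FE (F : {linear free_vect R X -> R^o}) :
    (forall i, F (b (p i).2.1) = F (b (p i).2.2)) ->
    F (b x) - F (b y) = c * F (b z).
  move=> Fp; rewrite -linearB -xy linearD linearZ linear_sum big1 ?add0r //.
  move=> i _; have [_ ->] := pP i.
  by rewrite linearZ_LR linearB Fp subrr scaler0.
have [A Ab] := free_vect_extension (fun _ : X => 1 : R^o).
have c0 : c = 0.
  have := FE A; rewrite !Ab subrr mulr1 => <- // i.
  by rewrite !Ab.
have [F Fb] := free_vect_extension (fun t => (`[<r x t>])%:R : R^o).
have := FE F; rewrite !Fb c0 mul0r (asboolT (rr x)) => Fxy.
apply: rd; apply: contrapT => nxy; move: Fxy; rewrite asboolF // subr0.
move=> Fp; suff /Fp/eqP : forall i, F (b (p i).2.1) = F (b (p i).2.2).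
  by rewrite oner_eq0.
move=> i; rewrite !Fb; congr (nat_of_bool _)%:R.
have rp : r (p i).2.1 (p i).2.2 by rewrite -qE; exact: rq.
apply: asbool_equiv_eq; split=> [/rt|/rt]; first exact.
by apply; exact: rs.
Qed.

(** One summand with coefficient 1, plus 0 times [b z], already suffices. *)
Lemma diff_set_generated e : E e -> generated_ideal (D e).
Proof.
move=> Ee; apply/generated_idealP; exists e, 1%N; split=> // u Du.
exists u.
  exists (fun=> u); last by rewrite big_ord1.
  by move=> _; exists 1; rewrite /= ?lexx ?(le_trans _ ler01) ?oppr_le0 //;
    exists u => //; rewrite scale1r.
by exists 0; rewrite ?addr0 //; apply: set_scale0 => //; exists (b z).
Qed.

Lemma generated_ideal_subballean :
  E = subballean_along (free_vect_basis R) (ideal_entourages generated_ideal).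
Proof.
apply/seteqP; split=> [e Ee|_ [d [U /generated_idealP[e [n [Ee n0 UB]]]
                                   [diagd dU]] <-]].
  (* Entourages of the ideal must contain the whole diagonal of the vector space; by injectivity of
     [b], adjoining it adds only diagonal pairs to the trace on $X$. *)
  exists (diagonal `|` [set (b p.1, b p.2) | p in e]).
    exists (D e); first exact: diff_set_generated.
    split; first exact: subsetUl.
    move=> q [xx|[p ep <-]]; last by exists p.
    by rewrite /= xx subrr; exact: diff_set0.
  apply/seteqP; split=> [[x y] /=|[x y] exy]; last by right; exists (x, y).
  case=> [xy|[[x' y'] exy [xx' yy']]].
    by apply: (coarse_diagonal hE Ee); exact: free_vect_basis_inj xy.
  by rewrite -(free_vect_basis_inj xx') -(free_vect_basis_inj yy').
have [c Ec cP] := free_ball_entourage n Ee.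
apply: (coarse_sub hE Ec) => [[x y] xy|[x y] /dU/UB/cP //].
by apply: diagd; exact: congr1 xy.
Qed.

(** * Universal property and identification of the free ideal *)

Lemma linear_free_ball (V : lmodType R) (F : {linear free_vect R X -> V}) e n :
  F @` free_ball e n `<=`
  set_sum (set_nsum n (set_scale n%:R (F @` D e)))
          (set_scale n%:R [set F (b z)]).
Proof.
have FZ (W : set (free_vect R X)) w :
    set_scale n%:R W w -> set_scale n%:R (F @` W) (F w).
  move=> [a an [v Wv <-]]; exists a => //; exists (F v); first by exists v.
  by rewrite linearZ.
move=> _ [_ [_ [u Du <-] [w Ww <-]] <-].
exists (F (\sum_(i < n) u i)).
  exists (fun i => F (u i)); last by rewrite linear_sum.
  by move=> i; exact: FZ.
exists (F w); last by rewrite linearD.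
by have := FZ _ _ Ww; rewrite image_set1.
Qed.

(** Coarseness on $X$ puts the image of [D e] in [J], and [linear_free_ball] bounds the image of a
    ball by operations under which [J] is closed. *)
Lemma generated_ideal_coarse (V : lmodType R) (J : set_system V)
    (F : {linear free_vect R X -> V}) : vector_ideal J ->
  coarse_map E (ideal_entourages J) (F \o b) ->
  coarse_map (ideal_entourages generated_ideal) (ideal_entourages J) F.
Proof.
move=> idJ cf d [U /generated_idealP[e [n [Ee n0 UB]]] [diagd dU]].
have [d' [W JW [_ d'W]] fd'] := cf _ Ee.
have JFD : J (F @` D e).
  apply: (vector_idealS idJ JW) => _ [_ [[x y] exy <-] <-].
  rewrite linearB; apply: (d'W (F (b x), F (b y))).
  suff : xsection d' (F (b x)) (F (b y)) by rewrite /xsection /= inE.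
  by apply: fd'; exists y => //; rewrite /xsection /= inE.
have n0' : (0 : R) < n%:R by rewrite ltr0n.
have JFB : J (F @` U).
  apply: (vector_idealS idJ); last first.
    apply: subset_trans (@linear_free_ball _ F e n).
    exact: image_subset.
  apply: vector_ideal_sum => //.
    by apply: vector_ideal_nsum => //; exact: vector_idealZ.
  by apply: vector_idealZ => //; exact: vector_ideal_set1.
exists [set p | (F @` U) (p.1 - p.2)].
  exists (F @` U) => //; split=> // -[x y]; rewrite /diagonal /= => ->.
  (* [U] contains 0 because [d] contains the diagonal pair [(0, 0)]. *)
  exists 0; last by rewrite linear0 subrr.
  by rewrite -(subrr (0 : free_vect R X)); apply: (dU (0, 0)); exact: diagd.
move=> x _ [y + <-]; rewrite /xsection /= !inE => /dU /= Uxy.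
by exists (x - y) => //; rewrite linearB.
Qed.

Lemma generated_ideal_free : is_free_vector_ideal E generated_ideal.
Proof.
split=> [||V J idJ f cf]; first exact: generated_ideal_vector_ideal.
  exact: generated_ideal_subballean.
have [F Fb] := free_vect_extension f.
exists F; split=> [|G [linG _ Gb]].
  split=> //; first exact: linearP.
  apply: generated_ideal_coarse => //.
  by rewrite (_ : F \o b = f) //; apply/funext.
apply: free_vect_linear_eq => //; first exact: linearP.
by move=> x; rewrite Fb Gb.
Qed.

(** Since a free ideal exists, [xget] returns one, and uniqueness identifies it with the generated
    ideal. *)
Lemma free_vector_idealE : free_vector_ideal R E = generated_ideal.
Proof.
apply: free_vector_ideal_unique generated_ideal_free.
exact: (xgetI set0 generated_ideal_free).
Qed.

End FreeVectorIdeal.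

Theorem theorem1 (R : realType) (X : Type) (E : set_system (X * X))
    (hE : coarse_structure E) (z : X) :
  ideal_base (free_vector_ideal R E)
    [set set_sum (set_nsum n (set_scale n%:R (diff_set R e)))
                 (set_scale n%:R [set free_vect_basis R z])
       | e in E & n in [set n : nat | (0 < n)%N]].
Proof.
rewrite (free_vector_idealE R hE z); split; last by [].
by move=> B BB; exists B.
Qed.
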